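(* For $k\in\{1,2\}$ let ${}^kG$ be a metagroup, ${}^kB$ a unital ${}^kG$-graded ${}^kA$-algebra with ${}^kA=\mathcal T[{}^kG]$, and ${}^k\mathcal C$ a ${}^kG$-graded ${}^kB$-complex, where $\mathcal T$ is a commutative associative unital ring. Let $f^1:{}^1\mathcal C\to{}^2\mathcal C$ be a $(({}^1B,{}^2B),({}^1B,{}^2B))$-generic homomorphism of complexes. If $f^1$ is a homotopism, then it is a homologism. Moreover, if $g^1:{}^1\mathcal C\to{}^2\mathcal C$ is a homomorphism homotopic to $f^1$, then $g^1$ also is a homotopism.
   Context: **Metagroups.** A metagroup is a set $G$ with a binary operation such that for all $a,b\in G$ there are a unique $x$ with $ax=b$ (written $a\setminus b$) and a unique $y$ with $ya=b$ (written $b/a$), there is a unit $e$ with $eg=ge=g$, and $(ab)c=\mathsf t_3(a,b,c)\,a(bc)$ for all $a,b,c\in G$ with $\mathsf t_3(a,b,c)\in\Psi$, where $\Psi$ is a subgroup of the center $\mathcal C(G)=Com(G)\cap N(G)$; here $Com(G)=\{a:\forall b,\ ab=ba\}$ and $N(G)$ is the set of $a$ with $(ab)c=a(bc)$, $(ba)c=b(ac)$, $(bc)a=b(ca)$ for all $b,c\in G$. For a bracketing $q(n)$, $\{g_1,\dots,g_n\}_{q(n)}$ is the product of $g_1,\dots,g_n$ in this order with that bracketing; $l(n)$ is the left-normed one: $\{g_1\}_{l(1)}=g_1$, $\{g_1,\dots,g_{n+1}\}_{l(n+1)}=\{g_1,\dots,g_n\}_{l(n)}g_{n+1}$. $t_n(g_1,\dots,g_n;q(n),v(n))\in\Psi$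 is the element with $\{g_1,\dots,g_n\}_{q(n)}=t_n(g_1,\dots,g_n;q(n),v(n))\{g_1,\dots,g_n\}_{v(n)}$. **Algebras.** $A=\mathcal T[G]$ is the algebra of formal finite sums $\sum s_ia_i$ ($s_i\in\mathcal T$, $a_i\in G$) with product extending that of $G$ $\mathcal T$-bilinearly and $sa=as$. Modules over a possibly nonassociative ring are abelian groups with a biadditive action (unital if $1m=m$). A $G$-graded $A$-bimodule is an $A$-bimodule $M$ (also a two-sided $\mathcal T$-module) with $M=\sum_{g\in G}M_g$ (not necessarily direct), $M_g$ two-sided $\mathcal T$-modules, $hM_g=M_{hg}$, $M_gh=M_{gh}$, $(bh)x_g=b(hx_g)$, $x_g(bh)=(x_gh)b$, $bx_g=x_gb$, $(hs)x_g=\mathsf t_3(h,s,g)h(sx_g)$, $(hx_g)s=\mathsf t_3(h,g,s)h(x_gs)$, $(x_gh)s=\mathsf t_3(g,h,s)x_g(hs)$ for $g,h,s\in G$, $b\in\mathcal T$, $x_g\in M_g$. A unital $G$-graded $A$-algebra is a $G$-graded $A$-bimodule $B$ with a $\mathcal T$-bilinear product ($(bx)y=b(xy)$, $(xb)y=x(by)$, $(xy)b=x(yb)$ for $b\in\mathcal T$), $B_gB_h\subseteq B_{gh}$, $(x_gy_h)z_s=\mathsf t_3(g,h,s)x_g(y_hz_s)$ for $x_g\in B_g,y_h\in B_h,z_s\in B_s$, and a two-sided unit $1_B$. $G\subset A$ acts through $A1_B\subset B$. $N(B)$ (nucleus) is the set of $x\in B$ with $(xb)c=x(bc)$, $(bx)c=b(xc)$,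 $(bc)x=b(cx)$ for all $b,c\in B$; $\mathsf C(B)$ is the set of $x\in N(B)$ commuting with all of $B$. **Smashly $G^n$-graded modules.** A two-sided $B$-module $X$ is (smashly) $G^n$-graded if there are two-sided $N(B)$-modules $X_{\{g_1,\dots,g_n\}_{q(n)}}$ with $X=\sum_{g_1,\dots,g_n\in G}X_{\{g_1,\dots,g_n\}_{l(n)}}$; left and right $N(B)$-linear isomorphisms $X_{\{g_1,\dots,g_n\}_{v(n)}}\to X_{\{g_1,\dots,g_n\}_{q(n)}}$ given by $x\mapsto t_n(g_1,\dots,g_n;q(n),v(n))x$; left and right $N(B)$-linear isomorphisms $g_0X_{\{g_1,\dots,g_n\}_{l(n)}}\to X_{\{(g_0g_1),\dots,g_n\}_{l(n)}}$ and $X_{\{g_1,\dots,g_n\}_{l(n)}}g_{n+1}\to X_{\{g_1,\dots,(g_ng_{n+1})\}_{l(n)}}$; and for $x\in X_{\{g_1,\dots,g_n\}_{l(n)}}$, $g=\{g_1,\dots,g_n\}_{l(n)}$, $h,k\in G$, $b\in\mathsf C(B)$: $(bh)x=b(hx)$, $x(bk)=(xk)b$, $bx=xb$, $(hk)x=\mathsf t_3(h,k,g)h(kx)$, $(hx)k=\mathsf t_3(h,g,k)h(xk)$, $(xh)k=\mathsf t_3(g,h,k)x(hk)$. $G$-graded means $n=1$. **Generic homomorphisms.** For unital ${}^jG$-graded ${}^jA$-algebras ${}^jB$, a $\mathcal T$-homomorphism $f:X\to Y$ from a left ${}^1B$-module to a left ${}^2B$-module is $({}^1B,{}^2B)$-generic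 if $f(ax+by)=f_\iota(a)f(x)+f_\iota(b)f(y)$ for some injective unital multiplicative $\mathcal T$-homomorphism $f_\iota:{}^1B\to{}^2B$ mapping ${}^1G$ to ${}^2G$ (respecting $\setminus$ and $/$), $N({}^1B)$ into $N({}^2B)$ and $\mathcal T[N({}^1G)]$ into $\mathcal T[N({}^2G)]$. Right versions are analogous. A homomorphism of bimodules which is $({}^1B,{}^2B)$-generic both as a left and as a right homomorphism is called $(({}^1B,{}^2B),({}^1B,{}^2B))$-generic. ''$B$-generic'' means ${}^1B={}^2B=B$. **Complexes.** A $G$-graded $B$-complex $(\mathcal C,d)$ is a $G$-graded $B$-bimodule with a $\mathbf Z$-gradation $(\mathcal C_n)$, $\mathcal C_n$ being $G^{|n|+2}$-graded, and a $\mathbf Z$-graded $B$-generic $d:\mathcal C\to\mathcal C$ of degree $-1$ with $dd=0$. A homomorphism of complexes is a generic homomorphism of degree $0$ commuting with the differentials. $H(\mathcal C)=\ker d/\operatorname{Im}d$, and $H(\psi)$ is the map induced on homology by a homomorphism $\psi$ of complexes; $\psi$ is a homologism if $H(\psi)$ is bijective. Two such homomorphisms $f,g:{}^1\mathcal C\to{}^2\mathcal C$ are homotopic if $g-f={}^2d\circ s+s\circ{}^1d$ for some $(({}^1B,{}^2B),({}^1B,{}^2B))$-generic homomorphism $s$ of $\mathbf Z$-degree $1$. A generic homomorphism $f^1:{}^1\mathcal C\to{}^2\mathcal C$ of complexes is a homotopism if there exists a $(({}^2B,{}^1B),({}^2B,{}^1B))$-generic homomorphism $f^2:{}^2\mathcal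 C\to{}^1\mathcal C$ of complexes such that $f^2\circ f^1$ and $f^1\circ f^2$ are homotopic to $1_{{}^1\mathcal C}$ and $1_{{}^2\mathcal C}$ respectively.
   Formalization: ''Homotopic'' is read as the equivalence relation generated by g − f = d s + s d with s generic (finite chains of such steps), since with a single generic s the relation is not transitive and the second assertion is false. *)

(* Defs.v *)
From HB Require Import structures.
From mathcomp Require Import all_boot all_order all_algebra.
From mathcomp Require Import finmap monalg boolp.
From Stdlib Require Relation_Operators.

Set Implicit Arguments.
Unset Strict Implicit.
Unset Printing Implicit Defensive.

Import GRing.Theory.
Local Open Scope ring_scope.
Local Open Scope quotient_scope.

Section Center.
Variables (S : Type) (op : S -> S -> S).

Definition nucleus (a : S) : Prop :=
  forall b c, [/\ op (op a b) c = op a (op b c),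
                  op (op b a) c = op b (op a c)
                & op (op b c) a = op b (op c a)].

Definition center (a : S) : Prop :=
  nucleus a /\ (forall b, op a b = op b a).

End Center.

(* [mldiv a b] is a \ b and [mrdiv b a] is b / a. *)
Record metagroup := Metagroup {
  mcar :> choiceType;
  mop : mcar -> mcar -> mcar;
  mldiv : mcar -> mcar -> mcar;
  mrdiv : mcar -> mcar -> mcar;
  munit : mcar;
  mPsi : mcar -> Prop;
  _ : forall a b x, mop a x = b <-> x = mldiv a b;
  _ : forall a b y, mop y a = b <-> y = mrdiv b a;
  _ : forall g, mop munit g = g;
  _ : forall g, mop g munit = g;
  _ : mPsi munit;
  _ : forall a b, mPsi a -> mPsi b -> mPsi (mop a b);
  _ : forall a, mPsi a -> mPsi (mldiv a munit);
  _ : forall a, mPsi a -> center mop a;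
  _ : forall a b c, exists2 t, mPsi t
        & mop (mop a b) c = mop t (mop a (mop b c))
}.

Arguments munit {_}.

Section MetagroupTheory.
Variable G : metagroup.
Local Notation "x ∘ y" := (@mop G x y) (at level 40, left associativity).

(* By uniqueness of right quotients this is the t_3 of the last axiom. *)
Definition mt3 (a b c : G) : G := mrdiv ((a ∘ b) ∘ c) (a ∘ (b ∘ c)).

Inductive bracketing := BLeaf | BNode of bracketing & bracketing.

Fixpoint leaves (q : bracketing) : nat :=
  if q is BNode q1 q2 then (leaves q1 + leaves q2)%N else 1%N.

(* The product of the list [s] bracketed by [q]; meaningful when
   [size s = leaves q]. *)
Fixpoint bprod (q : bracketing) (s : seq G) : G :=
  if q is BNode q1 q2
  then bprod q1 (take (leaves q1) s) ∘ bprod q2 (drop (leaves q1) s)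
  else head munit s.

(* The left-normed bracketing l(n), for n >= 1. *)
Definition lnormed (n : nat) : bracketing :=
  iter n.-1 (fun q => BNode q BLeaf) BLeaf.

Definition mtn (s : seq G) (q v : bracketing) : G :=
  mrdiv (bprod q s) (bprod v s).

End MetagroupTheory.

Inductive finsum (V : zmodType) (I : Type) (M : I -> V -> Prop) : V -> Prop :=
| finsum0 : finsum M 0
| finsumD i x y : M i x -> finsum M y -> finsum M (x + y).

(* [<< b *g g >>] is the formal sum with the single term b g. *)
Notation mgalg T G := {malg T[mcar G]}.

Section MetagroupAlgebra.
Variables (T : comPzRingType) (G : metagroup).

Definition mgalg_mul (a b : mgalg T G) : mgalg T G :=
  \sum_(g <- msupp a) \sum_(h <- msupp b) << a@_g * b@_h *g mop g h >>.

Definition mgalg_nuc (a : mgalg T G) : Prop :=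
  forall g, g \in msupp a -> nucleus (@mop G) g.

End MetagroupAlgebra.

(* The two-sided T-module structure of M is [*:%R] on both sides, which is
   what the axiom bx = xb for b in T amounts to. *)
Section GradedBimodule.
Variables (T : comPzRingType) (G : metagroup) (M : lmodType T).
Variables (la : mgalg T G -> M -> M) (ra : M -> mgalg T G -> M).
Variable Mg : G -> M -> Prop.
Local Notation "'u_' g" := (<< g >> : mgalg T G) (at level 0, g at level 2).

Record graded_bimodule : Prop := GradedBimodule {
  gb_laDl : forall a b x, la (a + b) x = la a x + la b x;
  gb_laDr : forall a x y, la a (x + y) = la a x + la a y;
  gb_raDl : forall x y a, ra (x + y) a = ra x a + ra y a;
  gb_raDr : forall x a b, ra x (a + b) = ra x a + ra x b;
  gb_sum : forall x, finsum Mg x;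
  gb_0 : forall g, Mg g 0;
  gb_D : forall g x y, Mg g x -> Mg g y -> Mg g (x + y);
  gb_Z : forall g b x, Mg g x -> Mg g (b *: x);
  gb_lshift : forall g h y,
    Mg (mop h g) y <-> exists2 x, Mg g x & y = la (u_ h) x;
  gb_rshift : forall g h y,
    Mg (mop g h) y <-> exists2 x, Mg g x & y = ra x (u_ h);
  gb_scalel : forall (b : T) g h x, Mg g x ->
    la << b *g h >> x = b *: la (u_ h) x;
  gb_scaler : forall (b : T) g h x, Mg g x ->
    ra x << b *g h >> = b *: ra x (u_ h);
  gb_ll : forall g h s x, Mg g x ->
    la (mgalg_mul (u_ h) (u_ s)) x
    = la (u_ (mt3 h s g)) (la (u_ h) (la (u_ s) x));
  gb_lr : forall g h s x, Mg g x ->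
    ra (la (u_ h) x) (u_ s)
    = la (u_ (mt3 h g s)) (la (u_ h) (ra x (u_ s)));
  gb_rr : forall g h s x, Mg g x ->
    ra (ra x (u_ h)) (u_ s)
    = la (u_ (mt3 g h s)) (ra x (mgalg_mul (u_ h) (u_ s)))
}.

End GradedBimodule.

Record graded_algebra (T : comPzRingType) (G : metagroup) := GradedAlgebra {
  bcar :> lmodType T;
  bla : mgalg T G -> bcar -> bcar;
  bra : bcar -> mgalg T G -> bcar;
  bcomp : G -> bcar -> Prop;
  bmul : bcar -> bcar -> bcar;
  bone : bcar;
  _ : graded_bimodule bla bra bcomp;
  _ : forall x y z, bmul (x + y) z = bmul x z + bmul y z;
  _ : forall x y z, bmul x (y + z) = bmul x y + bmul x z;
  _ : forall (b : T) x y, bmul (b *: x) y = b *: bmul x y;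
  _ : forall (b : T) x y, bmul x (b *: y) = b *: bmul x y;
  _ : forall g h x y, bcomp g x -> bcomp h y -> bcomp (mop g h) (bmul x y);
  _ : forall g h s x y z, bcomp g x -> bcomp h y -> bcomp s z ->
        bmul (bmul x y) z = bla << mt3 g h s >> (bmul x (bmul y z));
  _ : forall x, bmul bone x = x;
  _ : forall x, bmul x bone = x
}.

Arguments bone {T G _}.

Section AlgebraTheory.
Variables (T : comPzRingType) (G : metagroup) (B : graded_algebra T G).

(* The image a 1_B of a in A, and of g in G, through which A and G act on
   B-modules. *)
Definition bA (a : mgalg T G) : B := bla a bone.
Definition bG (g : G) : B := bA << g >>.

End AlgebraTheory.

Arguments bA {T G} B a.
Arguments bG {T G} B g.

(* A module over a nonassociative ring is an abelian group with a biadditive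
   action; it is not assumed to be unital.  T acts through T 1_B. *)
Record bimodule (T : comPzRingType) (G : metagroup) (B : graded_algebra T G) :=
  Bimodule {
  xcar :> zmodType;
  xl : B -> xcar -> xcar;
  xr : xcar -> B -> xcar;
  _ : forall a b x, xl (a + b) x = xl a x + xl b x;
  _ : forall a x y, xl a (x + y) = xl a x + xl a y;
  _ : forall x y a, xr (x + y) a = xr x a + xr y a;
  _ : forall x a b, xr x (a + b) = xr x a + xr x b
}.

Section SmashGraded.
Variables (T : comPzRingType) (G : metagroup) (B : graded_algebra T G).
Variable X : bimodule B.
Implicit Types P Q : X -> Prop.

Definition sub_bimodule_over (R : B -> Prop) P : Prop :=
  [/\ P 0,
      forall x y, P x -> P y -> P (x - y),
      forall b x, R b -> P x -> P (xl b x)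
    & forall b x, R b -> P x -> P (xr x b)].

Definition N_iso P Q (f : X -> X) : Prop :=
  [/\ sub_bimodule_over (nucleus (@bmul T G B)) P,
      sub_bimodule_over (nucleus (@bmul T G B)) Q
    & [/\ forall x, P x -> Q (f x),
          forall x y, P x -> P y -> f x = f y -> x = y
        & forall y, Q y -> exists2 x, P x & f x = y]]
  /\ [/\ forall x y, P x -> P y -> f (x + y) = f x + f y,
         forall b x, nucleus (@bmul T G B) b -> P x -> f (xl b x) = xl b (f x)
       & forall b x, nucleus (@bmul T G B) b -> P x -> f (xr x b) = xr (f x) b].

(* [smash_graded n P Xq]: the sub-bimodule P of X is smashly G^n-graded
   (n >= 1) by the subsets X_{{g_1,...,g_n}_{q(n)}} = [Xq q [:: g_1; ...; g_n]].
   The bracketed word is a formal index: it is not evaluated in G. *)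
Record smash_graded (n : nat) P (Xq : bracketing -> seq G -> X -> Prop) : Prop :=
  SmashGraded {
  sg_sub : forall q s, leaves q = n -> size s = n -> forall x, Xq q s x -> P x;
  sg_sub_bimodule : forall q s, leaves q = n -> size s = n ->
    sub_bimodule_over (nucleus (@bmul T G B)) (Xq q s);
  sg_sum : forall x, P x ->
    finsum (fun s x => size s = n /\ Xq (lnormed n) s x) x;
  sg_rebracket : forall q v s, leaves q = n -> leaves v = n -> size s = n ->
    N_iso (Xq v s) (Xq q s) (fun x => xl (bG B (mtn s q v)) x);
  sg_lshift : forall g0 g1 s, size (g1 :: s) = n -> exists f,
    N_iso (fun y => exists2 x, Xq (lnormed n) (g1 :: s) x & y = xl (bG B g0) x)
          (Xq (lnormed n) (mop g0 g1 :: s)) f;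
  sg_rshift : forall gn gn1 s, size (rcons s gn) = n -> exists f,
    N_iso (fun y => exists2 x, Xq (lnormed n) (rcons s gn) x
                             & y = xr x (bG B gn1))
          (Xq (lnormed n) (rcons s (mop gn gn1))) f;
  sg_scalel : forall s b h x, size s = n -> Xq (lnormed n) s x ->
    center (@bmul T G B) b -> xl (bmul b (bG B h)) x = xl b (xl (bG B h) x);
  sg_scaler : forall s b k x, size s = n -> Xq (lnormed n) s x ->
    center (@bmul T G B) b -> xr x (bmul b (bG B k)) = xr (xr x (bG B k)) b;
  sg_central : forall s b x, size s = n -> Xq (lnormed n) s x ->
    center (@bmul T G B) b -> xl b x = xr x b;
  sg_ll : forall s h k x, size s = n -> Xq (lnormed n) s x ->
    xl (bG B (mop h k)) x
    = xl (bG B (mt3 h k (bprod (lnormed n) s))) (xl (bG B h) (xl (bG B k) x));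
  sg_lr : forall s h k x, size s = n -> Xq (lnormed n) s x ->
    xr (xl (bG B h) x) (bG B k)
    = xl (bG B (mt3 h (bprod (lnormed n) s) k)) (xl (bG B h) (xr x (bG B k)));
  sg_rr : forall s h k x, size s = n -> Xq (lnormed n) s x ->
    xr (xr x (bG B h)) (bG B k)
    = xl (bG B (mt3 (bprod (lnormed n) s) h k)) (xr x (bG B (mop h k)))
}.

End SmashGraded.

Section Generic.
Variables (T : comPzRingType) (G1 G2 : metagroup).
Variables (B1 : graded_algebra T G1) (B2 : graded_algebra T G2).

(* The maps f_iota.  "1G is mapped to 2G" is understood for the images of the
   metagroups in the algebras. *)
Record generic_scalars (io : B1 -> B2) : Prop := GenericScalars {
  gs_inj : injective io;
  gs_add : forall a b, io (a + b) = io a + io b;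
  gs_scale : forall (t : T) a, io (t *: a) = t *: io a;
  gs_mul : forall a b, io (bmul a b) = bmul (io a) (io b);
  gs_one : io bone = bone;
  gs_metagroup : exists phi : G1 -> G2,
    [/\ forall g, io (bG B1 g) = bG B2 (phi g),
        forall a b, phi (mldiv a b) = mldiv (phi a) (phi b)
      & forall a b, phi (mrdiv a b) = mrdiv (phi a) (phi b)];
  gs_nucleus : forall a,
    nucleus (@bmul T G1 B1) a -> nucleus (@bmul T G2 B2) (io a);
  gs_nucleusG : forall a, mgalg_nuc a ->
    exists2 b, mgalg_nuc b & io (bA B1 a) = bA B2 b
}.

Variables (X : bimodule B1) (Y : bimodule B2).

Definition left_generic (f : X -> Y) : Prop :=
  [/\ forall x y, f (x + y) = f x + f y,
      forall (t : T) x, f (xl (t *: bone) x) = xl (t *: bone) (f x)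
    & exists2 io, generic_scalars io
      & forall a b x y, f (xl a x + xl b y) = xl (io a) (f x) + xl (io b) (f y)].

Definition right_generic (f : X -> Y) : Prop :=
  [/\ forall x y, f (x + y) = f x + f y,
      forall (t : T) x, f (xr x (t *: bone)) = xr (f x) (t *: bone)
    & exists2 io, generic_scalars io
      & forall a b x y, f (xr x a + xr y b) = xr (f x) (io a) + xr (f y) (io b)].

Definition generic (f : X -> Y) : Prop := left_generic f /\ right_generic f.

End Generic.

Definition z_degree (X Y : zmodType) (Xn : int -> X -> Prop)
    (Yn : int -> Y -> Prop) (k : int) (f : X -> Y) : Prop :=
  forall n x, Xn n x -> Yn (n + k) (f x).

Record complex (T : comPzRingType) (G : metagroup) (B : graded_algebra T G) :=
  Complex {
  ccar :> bimodule B;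
  cG : bracketing -> seq G -> ccar -> Prop;
  cdeg : int -> ccar -> Prop;
  cdegG : int -> bracketing -> seq G -> ccar -> Prop;
  cdiff : ccar -> ccar;
  _ : smash_graded 1 (fun=> True) cG;
  _ : forall n, sub_bimodule_over (fun=> True) (cdeg n);
  _ : forall x, finsum cdeg x;
  _ : forall (s : seq int) (c : int -> ccar), uniq s ->
        (forall n, cdeg n (c n)) -> \sum_(n <- s) c n = 0 ->
        forall n, n \in s -> c n = 0;
  _ : forall n : int, smash_graded (absz n).+2 (cdeg n) (cdegG n);
  cdiff_generic : generic cdiff;
  _ : z_degree cdeg cdeg (-1) cdiff;
  cdiff2 : forall x, cdiff (cdiff x) = 0
}.

Record complex_hom (T : comPzRingType) (G1 G2 : metagroup)
    (B1 : graded_algebra T G1) (B2 : graded_algebra T G2)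
    (C1 : complex B1) (C2 : complex B2) := ComplexHom {
  chom :> C1 -> C2;
  chom_generic : generic chom;
  chom_deg : z_degree (@cdeg _ _ _ C1) (@cdeg _ _ _ C2) 0 chom;
  chom_diff : forall x, chom (cdiff x) = cdiff (chom x)
}.

Section Composition.
Variable T : comPzRingType.

Lemma generic_scalars_id (G : metagroup) (B : graded_algebra T G) :
  generic_scalars (id : B -> B).
Proof.
split=> //; last by move=> a Na; exists a.
by exists id.
Qed.

Lemma generic_scalars_comp (G1 G2 G3 : metagroup) (B1 : graded_algebra T G1)
    (B2 : graded_algebra T G2) (B3 : graded_algebra T G3)
    (io' : B2 -> B3) (io : B1 -> B2) :
  generic_scalars io' -> generic_scalars io -> generic_scalars (io' \o io).
Proof.
move=> [i1 a1 s1 m1 o1 [p1 [g1 l1 r1]] n1 t1] [i2 a2 s2 m2 o2 [p2 [g2 l2 r2]] n2 t2].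
split=> /=.
- exact: inj_comp.
- by move=> a b; rewrite a2 a1.
- by move=> t a; rewrite s2 s1.
- by move=> a b; rewrite m2 m1.
- by rewrite o2 o1.
- exists (p1 \o p2); split=> [g|a b|a b] /=; first by rewrite g2 g1.
    by rewrite l2 l1.
  by rewrite r2 r1.
- by move=> a /n2 /n1.
- by move=> a /t2[b /t1[c Nc Ec] Eb]; exists c => //; rewrite Eb.
Qed.

Lemma generic_id (G : metagroup) (B : graded_algebra T G) (X : bimodule B) :
  generic (id : X -> X).
Proof. by split; split=> //; exists id => //; exact: generic_scalars_id. Qed.

Lemma generic_comp (G1 G2 G3 : metagroup) (B1 : graded_algebra T G1)
    (B2 : graded_algebra T G2) (B3 : graded_algebra T G3)
    (X : bimodule B1) (Y : bimodule B2) (Z : bimodule B3)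
    (f' : Y -> Z) (f : X -> Y) :
  generic f' -> generic f -> generic (f' \o f).
Proof.
move=> [[la' lt' [li' Hli' le']] [ra' rt' [ri' Hri' re']]].
move=> [[la lt [li Hli le]] [ra rt [ri Hri re]]].
split; split=> /=.
- by move=> x y; rewrite la la'.
- by move=> t x; rewrite lt lt'.
- exists (li' \o li); first exact: generic_scalars_comp.
  by move=> a b x y; rewrite le le'.
- by move=> x y; rewrite ra ra'.
- by move=> t x; rewrite rt rt'.
- exists (ri' \o ri); first exact: generic_scalars_comp.
  by move=> a b x y; rewrite re re'.
Qed.

Definition complex_id (G : metagroup) (B : graded_algebra T G)
    (C : complex B) : complex_hom C C.
Proof.
exists id; [exact: generic_id | | by []].
by move=> n x; rewrite addr0.
Defined.

Definition complex_comp (G1 G2 G3 : metagroup) (B1 : graded_algebra T G1)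
    (B2 : graded_algebra T G2) (B3 : graded_algebra T G3)
    (C1 : complex B1) (C2 : complex B2) (C3 : complex B3)
    (f' : complex_hom C2 C3) (f : complex_hom C1 C2) : complex_hom C1 C3.
Proof.
exists (f' \o f).
- exact: generic_comp (chom_generic f') (chom_generic f).
- by move=> n x /(chom_deg f); rewrite addr0 => /(chom_deg f'); rewrite addr0.
- by move=> x /=; rewrite !chom_diff.
Defined.

End Composition.

Section Homology.
Variables (T : comPzRingType) (G : metagroup) (B : graded_algebra T G).
Variable C : complex B.

Fact cdiff_zmod_morphism : zmod_morphism (@cdiff _ _ _ C).
Proof.
have [[dD _ _] _] := cdiff_generic C.
have d0 : @cdiff _ _ _ C 0 = 0.
  by apply: (addIr (cdiff (0 : C))); rewrite -dD !add0r.
have dN x : cdiff (- x) = - cdiff x :> C.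
  by apply: (addIr (cdiff x)); rewrite -dD !addNr.
by move=> x y; rewrite dD dN.
Qed.

HB.instance Definition _ :=
  GRing.isZmodMorphism.Build C C (@cdiff _ _ _ C) cdiff_zmod_morphism.

Definition cycle_pred : {pred C} := [pred x : C | cdiff x == 0].

Fact cycle_zmod_closed : zmod_closed cycle_pred.
Proof.
split=> [|x y]; rewrite !inE ?raddf0 // => /eqP dx /eqP dy.
by rewrite raddfB /= dx dy subrr.
Qed.

HB.instance Definition _ :=
  GRing.isZmodClosed.Build C cycle_pred cycle_zmod_closed.

Record cycles := Cycle { cycle_val :> C; cycleP : cycle_val \in cycle_pred }.

HB.instance Definition _ := [isSub for cycle_val].
HB.instance Definition _ := [Choice of cycles by <:].
HB.instance Definition _ := [SubChoice_isSubZmodule of cycles by <:].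

Definition boundary_pred : {pred cycles} :=
  [pred z : cycles | `[< exists c : C, cycle_val z = cdiff c >]].

Fact boundary_zmod_closed : zmod_closed boundary_pred.
Proof.
split=> [|x y]; rewrite !inE; first by apply/asboolP; exists 0; rewrite raddf0.
move=> /asboolP[a xE] /asboolP[b yE]; apply/asboolP; exists (a - b).
by rewrite raddfB /= -xE -yE.
Qed.

HB.instance Definition _ :=
  GRing.isZmodClosed.Build cycles boundary_pred boundary_zmod_closed.

Definition homology : zmodType := Quotient.quot boundary_pred.

End Homology.

Arguments cycle_pred {T G B} C.
Arguments cycles {T G B} C.
Arguments homology {T G B} C.

Section HomologyMap.
Variables (T : comPzRingType) (G1 G2 : metagroup).
Variables (B1 : graded_algebra T G1) (B2 : graded_algebra T G2).
Variables (C1 : complex B1) (C2 : complex B2) (f : complex_hom C1 C2).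

Fact chom_additive x y : f (x + y) = f x + f y.
Proof. by have [[fD _ _] _] := chom_generic f. Qed.

Fact chom_zmod_morphism : zmod_morphism f.
Proof.
have f0 : f 0 = 0 by apply: (addIr (f 0)); rewrite -chom_additive !add0r.
have fN x : f (- x) = - f x.
  by apply: (addIr (f x)); rewrite -chom_additive !addNr.
by move=> x y; rewrite chom_additive fN.
Qed.

HB.instance Definition _ := GRing.isZmodMorphism.Build C1 C2 f chom_zmod_morphism.

Fact chom_cycle (z : cycles C1) : f z \in cycle_pred C2.
Proof.
have := cycleP z; rewrite !inE -chom_diff => /eqP ->.
by rewrite raddf0.
Qed.

Definition cycle_map (z : cycles C1) : cycles C2 := Cycle (chom_cycle z).

Definition homology_map (h : homology C1) : homology C2 :=
  \pi_(homology C2) (cycle_map (repr h)).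

Lemma homology_mapE (z : cycles C1) :
  homology_map (\pi_(homology C1) z) = \pi_(homology C2) (cycle_map z).
Proof.
rewrite /homology_map; case: piP => z' /eqP; rewrite eqmodE => Ez.
apply/eqP; rewrite eqmodE.
move: Ez; rewrite /= /Quotient.equiv !inE => /asboolP[c Ec]; apply/asboolP.
exists (- f c); rewrite raddfN /= -chom_diff -Ec.
by rewrite raddfB opprB.
Qed.

Definition homologism : Prop := bijective homology_map.

End HomologyMap.

Section Homotopy.
Variables (T : comPzRingType) (G1 G2 : metagroup).
Variables (B1 : graded_algebra T G1) (B2 : graded_algebra T G2).
Variables (C1 : complex B1) (C2 : complex B2).

Definition homotopy (s : C1 -> C2) (f g : complex_hom C1 C2) : Prop :=
  [/\ generic s, z_degree (@cdeg _ _ _ C1) (@cdeg _ _ _ C2) 1 s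
    & forall x, g x - f x = cdiff (s x) + s (cdiff x)].

(* A sum of generic maps with different f_iota need not be generic, so the
   relation [exists s, homotopy s f g], although reflexive and symmetric, is
   not transitive.  Being homotopic is the equivalence relation it generates,
   that is, its transitive closure. *)
Definition homotopic : complex_hom C1 C2 -> complex_hom C1 C2 -> Prop :=
  Relation_Operators.clos_trans _ (fun f g => exists s, homotopy s f g).

End Homotopy.

Definition homotopism (T : comPzRingType) (G1 G2 : metagroup)
    (B1 : graded_algebra T G1) (B2 : graded_algebra T G2)
    (C1 : complex B1) (C2 : complex B2) (f1 : complex_hom C1 C2) : Prop :=
  exists f2 : complex_hom C2 C1,
    homotopic (complex_comp f2 f1) (complex_id C1)
    /\ homotopic (complex_comp f1 f2) (complex_id C2).

(* Main.v *)
Require Import Defs.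
From mathcomp Require Import all_boot all_order all_algebra.
From mathcomp Require Import boolp.
From Stdlib Require Import Relation_Operators.

Set Implicit Arguments.
Unset Strict Implicit.
Unset Printing Implicit Defensive.

Import GRing.Theory.
Local Open Scope ring_scope.
Local Open Scope quotient_scope.

(** If [g - f = d s + s d], then [f] and [g] agree on cycles up to boundaries,
    so homotopic maps induce the same map on homology and the homotopy inverse
    of [f1] inverts [H(f1)].  Homotopies can be negated and composed on either
    side with homomorphisms of complexes, hence a homotopy inverse of [f1] is
    also one of every [g1] homotopic to [f1]. *)

Section Bimodule.
Variables (T : comPzRingType) (G : metagroup) (B : graded_algebra T G).
Variable X : bimodule B.

Lemma xlN (a : B) (x : X) : xl a (- x) = - xl a x.
Proof.
case: X x => V l r lDl lDr rDl rDr /= x.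
have l0 : l a 0 = 0 by apply: (addIr (l a 0)); rewrite -lDr !add0r.
by apply: (addIr (l a x)); rewrite -lDr !addNr.
Qed.

Lemma xrN (a : B) (x : X) : xr (- x) a = - xr x a.
Proof.
case: X x => V l r lDl lDr rDl rDr /= x.
have r0 : r 0 a = 0 by apply: (addIr (r 0 a)); rewrite -rDl !add0r.
by apply: (addIr (r x a)); rewrite -rDl !addNr.
Qed.

End Bimodule.

(** The negative keeps the scalar maps [li] and [ri], since both actions are additive in the module
    variable. This makes a homotopy reversible. *)
Lemma generic_opp (T : comPzRingType) (G1 G2 : metagroup)
    (B1 : graded_algebra T G1) (B2 : graded_algebra T G2)
    (X : bimodule B1) (Y : bimodule B2) (f : X -> Y) :
  generic f -> generic (fun x => - f x).
Proof.
move=> [[lD lT [li Hli lE]] [rD rT [ri Hri rE]]].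
split; split.
- by move=> x y; rewrite lD opprD.
- by move=> t x; rewrite lT xlN.
- by exists li => // a b x y; rewrite lE opprD !xlN.
- by move=> x y; rewrite rD opprD.
- by move=> t x; rewrite rT xrN.
- by exists ri => // a b x y; rewrite rE opprD !xrN.
Qed.

Lemma cdegN (T : comPzRingType) (G : metagroup) (B : graded_algebra T G)
    (C : complex B) n (x : C) : cdeg n x -> cdeg n (- x).
Proof.
case: C x => V cG' deg degG d sg sub sum dir sgn dg dd d2 /= x.
by have [P0 PB _ _] := sub n => Px; rewrite -[- x]add0r; apply: PB.
Qed.

Section Homotopic.
Variables (T : comPzRingType) (G1 G2 : metagroup).
Variables (B1 : graded_algebra T G1) (B2 : graded_algebra T G2).
Variables (C1 : complex B1) (C2 : complex B2).
Implicit Types f g : complex_hom C1 C2.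

Lemma homotopy_opp s f g : homotopy s f g -> homotopy (fun x => - s x) g f.
Proof.
case=> Gs Ds E; split; first exact: generic_opp.
  by move=> n x /Ds /cdegN.
by move=> x; rewrite -opprB E opprD raddfN.
Qed.

(** A single homotopy reverses through [- s]; a chain of them is then read backwards. *)
Lemma homotopic_sym f g : homotopic f g -> homotopic g f.
Proof.
elim=> {f g} [f g [s fsg]|f g h _ IHfg _ IHgh].
  by apply: t_step; exists (fun x => - s x); apply: homotopy_opp.
exact: t_trans IHgh IHfg.
Qed.

Lemma homotopic_homology_map f g :
  homotopic f g -> homology_map f =1 homology_map g.
Proof.
elim=> {f g} [f g [s [[[sD _ _] _] _ E]]|f g h _ IHfg _ IHgh] z; last first.
  by rewrite IHfg IHgh.
rewrite -[z]reprK; move: (repr z) => {}z.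
(* The equality is flipped so that the difference to be bounded is [g z - f z], as in [homotopy]. *)
rewrite !homology_mapE; apply/esym/eqP; rewrite eqmodE.
rewrite /= /Quotient.equiv inE; apply/asboolP; exists (s z).
(* On a cycle the term [s (cdiff z)] is [s 0], so only the boundary of [s z] remains. *)
have s0 : s 0 = 0 by apply: (addIr (s 0)); rewrite -sD !add0r.
have := cycleP z; rewrite inE => /eqP dz.
by rewrite /= E dz s0 addr0.
Qed.

End Homotopic.

Section Composition.
Variables (T : comPzRingType) (G1 G2 G3 : metagroup).
Variables (B1 : graded_algebra T G1) (B2 : graded_algebra T G2).
Variable B3 : graded_algebra T G3.
Variables (C1 : complex B1) (C2 : complex B2) (C3 : complex B3).

(** Each link [s] of the chain becomes [h \o s]: [h] is additive and commutes with the
    differentials, and scalar maps compose. *)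
Lemma homotopic_compl (h : complex_hom C2 C3) (f g : complex_hom C1 C2) :
  homotopic f g -> homotopic (complex_comp h f) (complex_comp h g).
Proof.
elim=> {f g} [f g [s [Gs Ds E]]|f g k _ IHfg _ IHgk]; last exact: t_trans IHgk.
apply: t_step; exists (h \o s); split.
- exact: generic_comp (chom_generic h) Gs.
- by move=> n x /Ds /(chom_deg h); rewrite addr0.
- by move=> x; rewrite /= -raddfB /= E raddfD /= chom_diff.
Qed.

Lemma homotopic_compr (h : complex_hom C1 C2) (f g : complex_hom C2 C3) :
  homotopic f g -> homotopic (complex_comp f h) (complex_comp g h).
Proof.
elim=> {f g} [f g [s [Gs Ds E]]|f g k _ IHfg _ IHgk]; last exact: t_trans IHgk.
(* Here [h] acts first, so its commutation with the differential is used inside [s]. *)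
apply: t_step; exists (s \o h); split.
- exact: generic_comp Gs (chom_generic h).
- by move=> n x /(chom_deg h); rewrite addr0 => /Ds.
- by move=> x; rewrite /= E chom_diff.
Qed.

Lemma homology_map_comp (g : complex_hom C2 C3) (f : complex_hom C1 C2) z :
  homology_map (complex_comp g f) z = homology_map g (homology_map f z).
Proof.
rewrite -[z]reprK; move: (repr z) => {}z.
rewrite (homology_mapE f) !homology_mapE.
(* The two cycles have the same underlying element and differ only in their membership proofs. *)
by congr (\pi_(homology C3) _); apply: val_inj.
Qed.

End Composition.

Lemma homology_map_id (T : comPzRingType) (G : metagroup)
    (B : graded_algebra T G) (C : complex B) :
  homology_map (complex_id C) =1 id.
Proof.
move=> z; rewrite -[z]reprK; move: (repr z) => {}z; rewrite homology_mapE.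
by congr (\pi_(homology C) _); apply: val_inj.
Qed.

Lemma homotopism_homologism (T : comPzRingType) (G1 G2 : metagroup)
    (B1 : graded_algebra T G1) (B2 : graded_algebra T G2)
    (C1 : complex B1) (C2 : complex B2) (f : complex_hom C1 C2) :
  homotopism f -> homologism f.
Proof.
case=> f' [f'f ff']; exists (homology_map f') => z.
  by rewrite -homology_map_comp (homotopic_homology_map f'f) homology_map_id.
by rewrite -homology_map_comp (homotopic_homology_map ff') homology_map_id.
Qed.

Lemma homotopic_homotopism (T : comPzRingType) (G1 G2 : metagroup)
    (B1 : graded_algebra T G1) (B2 : graded_algebra T G2)
    (C1 : complex B1) (C2 : complex B2) (f g : complex_hom C1 C2) :
  homotopic f g -> homotopism f -> homotopism g.
Proof.
move=> /homotopic_sym gf [f' [f'f ff']]; exists f'; split.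
  (* The chain runs from [f' g] to [f' f] to the identity; the other side is its mirror image. *)
  by apply: t_trans f'f; apply: homotopic_compl.
by apply: t_trans ff'; apply: homotopic_compr.
Qed.

Theorem proposition2p22 (T : comPzRingType) (G1 G2 : metagroup)
    (B1 : graded_algebra T G1) (B2 : graded_algebra T G2)
    (C1 : complex B1) (C2 : complex B2) (f1 : complex_hom C1 C2) :
  homotopism f1 ->
  homologism f1
  /\ (forall g1 : complex_hom C1 C2, homotopic f1 g1 -> homotopism g1).
Proof.
move=> Hf; split; first exact: homotopism_homologism.
by move=> g1 fg; apply: homotopic_homotopism Hf.
Qed.
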